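(* Let $\mathcal{A}=(a_{ijk})$ be a 3rd order 3-dimensional real symmetric tensor with $a_{iii}>0$ for all $i\in\{1,2,3\}$. Suppose that $a_{123}\ge0$ and that there exist $r,s,t\in\{1,2,3\}$ with $r\neq s$, $s\neq t$, $r\neq t$ such that $$a_{rss}\ge\sqrt[3]{a_{rrr}a_{sss}^2},\qquad a_{rtt}\ge\sqrt[3]{a_{rrr}a_{ttt}^2}$$ and one of the following two conditions holds: (1) $a_{rrs}\ge0$, $a_{rrt}\ge-\sqrt[3]{a_{rrr}^2a_{ttt}}$, $a_{sst}\ge0$, $a_{stt}\ge0$; (2) $a_{rrs}\ge-\sqrt[3]{a_{rrr}^2a_{sss}}$, $a_{rrt}\ge0$, $a_{sst}\ge-\sqrt[3]{a_{sss}^2a_{ttt}}$, $a_{stt}\ge\sqrt[3]{a_{sss}a_{ttt}^2}$. Then $\mathcal{A}$ is strictly copositive.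
   Context: A 3rd order 3-dimensional real symmetric tensor is an array $\mathcal{A}=(a_{ijk})_{1\le i,j,k\le 3}$ of real numbers whose entries are invariant under every permutation of the indices. For $x=(x_1,x_2,x_3)^\top\in\mathbb{R}^3$ put $\mathcal{A}x^3=\sum_{i,j,k=1}^3 a_{ijk}x_ix_jx_k$. $\mathcal{A}$ is strictly copositive if $\mathcal{A}x^3>0$ for every $x\neq 0$ with $x_1,x_2,x_3\ge 0$. *)

(* Defs.v *)
From HB Require Import structures.
From mathcomp Require Import all_boot all_order all_algebra.
From mathcomp Require Import reals exp.

Set Implicit Arguments.
Unset Strict Implicit.
Unset Printing Implicit Defensive.

Import Order.TTheory GRing.Theory Num.Theory.
Local Open Scope ring_scope.

(* The indices 1, 2, 3 are represented by the elements 0, 1, 2 of 'I_3. *)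
Definition tensor3 (R : realType) : Type := 'I_3 -> 'I_3 -> 'I_3 -> R.

Definition symmetric_tensor (R : realType) (A : tensor3 R) : Prop :=
  forall i j k : 'I_3,
    [/\ A i k j = A i j k, A j i k = A i j k, A j k i = A i j k,
        A k i j = A i j k & A k j i = A i j k].

Definition tensor_form (R : realType) (A : tensor3 R) (x : 'cV[R]_3) : R :=
  \sum_(i < 3) \sum_(j < 3) \sum_(k < 3)
    A i j k * x i 0 * x j 0 * x k 0.

Definition strictly_copositive (R : realType) (A : tensor3 R) : Prop :=
  forall x : 'cV[R]_3,
    x != 0 -> (forall i : 'I_3, 0 <= x i 0) -> 0 < tensor_form A x.

(* powR is not an odd function on negative bases, hence the sign: this is
   the real cube root on the whole line, see cbrtK. *)
Definition cbrt (R : realType) (x : R) : R := Num.sg x * `|x| `^ 3^-1.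

Lemma cbrtK (R : realType) (x : R) : cbrt x ^+ 3 = x.
Proof.
have h : (`|x| `^ 3^-1) ^+ 3 = `|x|.
  by rewrite -powR_mulrn ?powR_ge0// -powRrM mulVf ?pnatr_eq0// powRr1.
rewrite /cbrt exprMn h [RHS]numEsg; congr (_ * _).
by case: sgrP => _; rewrite ?expr0n ?expr1n // exprS sqrrN expr1n mulr1.
Qed.

(* Main.v *)
(* Put X, Y, Z for the coordinates x_r, x_s, x_t multiplied by the cube roots
   of the corresponding diagonal entries. Under (1) the form is at least
   X (X^2 - 3 X Z + 3 Z^2) + Y^3 + Z^3, and under (2) it is at least
   X (X^2 - 3 X Y + 3 Y^2) + Y (Y^2 - 3 Y Z + 3 Z^2) + Z^3.
   Since U^2 - 3 U V + 3 V^2 = U^2 / 4 + 3 (U / 2 - V)^2, both are bounded below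
   by (X^3 + Y^3 + Z^3) / 4. *)
Require Import Defs.
From mathcomp Require Import all_boot all_order all_algebra.
From mathcomp Require Import reals exp ring lra.

Set Implicit Arguments.
Unset Strict Implicit.
Unset Printing Implicit Defensive.

Import Order.TTheory GRing.Theory Num.Theory.
Local Open Scope ring_scope.

Lemma cbrt_ge0 (R : realType) (x : R) : 0 <= x -> 0 <= cbrt x.
Proof. by move=> x0; rewrite /cbrt mulr_ge0 ?powR_ge0// sgr_ge0. Qed.

Lemma cbrt_gt0 (R : realType) (x : R) : 0 < x -> 0 < cbrt x.
Proof.
by move=> x0; rewrite /cbrt gtr0_sg// mul1r powR_gt0 ?normr_gt0 ?gt_eqF.
Qed.

Lemma exprK_cbrt (R : realType) (x : R) : 0 <= x -> cbrt (x ^+ 3) = x.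
Proof.
move=> x0; apply/eqP; rewrite -(@eqrXn2 _ 3)// ?cbrtK//.
by rewrite cbrt_ge0// exprn_ge0.
Qed.

Lemma cbrtMXX (R : realType) (x y : R) : 0 <= x -> 0 <= y ->
  cbrt (x ^+ 3 * (y ^+ 3) ^+ 2) = x * y ^+ 2.
Proof.
move=> x0 y0; rewrite exprAC -exprMn exprK_cbrt//.
by rewrite mulr_ge0 ?exprn_ge0.
Qed.

Lemma sum_distinct3 (V : nmodType) (F : 'I_3 -> V) (r s t : 'I_3) :
  r != s -> s != t -> r != t -> \sum_i F i = F r + F s + F t.
Proof.
move=> rs st rt; have u : uniq [:: r; s; t] by rewrite /= !inE negb_or rs rt st.
(* A duplicate-free list contained in the enumeration and at least as long has the same elements, so
   it is a permutation of it. *)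
have [||_ e] := uniq_min_size u (s2 := enum 'I_3).
- by move=> i; rewrite mem_enum.
- by rewrite size_enum_ord.
rewrite -big_enum (perm_big [:: r; s; t]) /=; last first.
  by rewrite perm_sym uniq_perm ?enum_uniq.
by rewrite !big_cons big_nil addr0 addrA.
Qed.

(** By symmetry the coefficient depends only on the multiset of indices, which comes from 1, 3 or 6
    ordered triples according as it has one, two or three distinct elements. *)
Lemma tensor_form_distinct3 (R : realType) (A : tensor3 R) (x : 'cV[R]_3)
    (r s t : 'I_3) : symmetric_tensor A -> r != s -> s != t -> r != t ->
  tensor_form A x =
    A r r r * x r 0 ^+ 3 + A s s s * x s 0 ^+ 3 + A t t t * x t 0 ^+ 3
    + (A r r s * (x r 0 ^+ 2 * x s 0) + A r s s * (x r 0 * x s 0 ^+ 2)) *+ 3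
    + (A r r t * (x r 0 ^+ 2 * x t 0) + A r t t * (x r 0 * x t 0 ^+ 2)) *+ 3
    + (A s s t * (x s 0 ^+ 2 * x t 0) + A s t t * (x s 0 * x t 0 ^+ 2)) *+ 3
    + A r s t * (x r 0 * x s 0 * x t 0) *+ 6.
Proof.
move=> Asym rs st rt; rewrite /tensor_form.
rewrite !(sum_distinct3 _ rs st rt).
have [-> -> -> -> ->] := Asym r s t.
have [-> _ _ -> _] := Asym r r s; have [_ -> -> _ _] := Asym r s s.
have [-> _ _ -> _] := Asym r r t; have [_ -> -> _ _] := Asym r t t.
have [-> _ _ -> _] := Asym s s t; have [_ -> -> _ _] := Asym s t t.
ring.
Qed.

(** This carries the sign of $a_{123}$ over to any labelling. Of the 27 choices of [r], [s], [t],
    those with a repeated index contradict distinctness; the other six are permutations. *)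
Lemma symmetric_tensor_distinct3 (R : realType) (A : tensor3 R) (r s t : 'I_3) :
  symmetric_tensor A -> r != s -> s != t -> r != t ->
  A r s t = A (inord 0) (inord 1) (inord 2).
Proof.
move=> Asym.
have [E1 E2 E3 E4 E5] := Asym (inord 0) (inord 1) (inord 2).
have I3 (i : 'I_3) : [\/ i = inord 0, i = inord 1 | i = inord 2].
  case: i => -[|[|[|//]]] lti; [constructor 1|constructor 2|constructor 3];
  by apply: val_inj; rewrite /= inordK.
by case: (I3 r) => ->; case: (I3 s) => ->; case: (I3 t) => ->; rewrite ?eqxx.
Qed.

Lemma quarter_cube_le (R : realType) (u v : R) : 0 <= u ->
  u ^+ 3 / 4 <= u ^+ 3 - 3 * (u ^+ 2 * v) + 3 * (u * v ^+ 2).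
Proof.
move=> u0; rewrite -subr_ge0.
have -> : u ^+ 3 - 3 * (u ^+ 2 * v) + 3 * (u * v ^+ 2) - u ^+ 3 / 4 =
  3 * (u * (u / 2 - v) ^+ 2) by field.
by rewrite mulr_ge0// mulr_ge0// sqr_ge0.
Qed.

Theorem corollary3p9 (R : realType) (A : tensor3 R)
  (Asym : symmetric_tensor A)
  (Adiag : forall i : 'I_3, 0 < A i i i)
  (A123 : 0 <= A (inord 0) (inord 1) (inord 2))
  (Arst : exists r s t : 'I_3,
    [/\ [/\ r != s, s != t & r != t],
        A r s s >= cbrt (A r r r * A s s s ^+ 2),
        A r t t >= cbrt (A r r r * A t t t ^+ 2) &
        [/\ A r r s >= 0,
            A r r t >= - cbrt (A r r r ^+ 2 * A t t t),
            A s s t >= 0 &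
            A s t t >= 0]
        \/
        [/\ A r r s >= - cbrt (A r r r ^+ 2 * A s s s),
            A r r t >= 0,
            A s s t >= - cbrt (A s s s ^+ 2 * A t t t) &
            A s t t >= cbrt (A s s s * A t t t ^+ 2)]]) :
  strictly_copositive A.
Proof.
case: Arst => r [s [t [[rs st rt] + + Hor]]] x x0 xge0.
(* With the diagonal entries written as cubes, [cbrtMXX] turns every cube root in the hypotheses
   into a monomial in [a], [b], [c]. *)
have [a a0 Ea] : exists2 a : R, 0 < a & A r r r = a ^+ 3.
  by exists (cbrt (A r r r)); rewrite ?cbrt_gt0 ?cbrtK.
have [b b0 Eb] : exists2 b : R, 0 < b & A s s s = b ^+ 3.
  by exists (cbrt (A s s s)); rewrite ?cbrt_gt0 ?cbrtK.
have [c c0 Ec] : exists2 c : R, 0 < c & A t t t = c ^+ 3.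
  by exists (cbrt (A t t t)); rewrite ?cbrt_gt0 ?cbrtK.
rewrite -(symmetric_tensor_distinct3 Asym rs st rt) in A123.
have [xr xs xt] := And3 (xge0 r) (xge0 s) (xge0 t).
have cubes_gt0 :
    0 < (a * x r 0) ^+ 3 + (b * x s 0) ^+ 3 + (c * x t 0) ^+ 3.
  have le3 (k y : R) : 0 < k -> 0 <= y -> 0 <= (k * y) ^+ 3.
    by move=> k0 y0; rewrite exprn_ge0 // mulr_ge0 // ltW.
  rewrite lt0r !addr_ge0 ?le3// andbT; apply: contra x0.
  rewrite !paddr_eq0 ?addr_ge0 ?le3// !expf_eq0 /=.
  rewrite !mulf_eq0 (gt_eqF a0) (gt_eqF b0) (gt_eqF c0) /=.
  move=> /andP[/andP[/eqP xr0 /eqP xs0] /eqP xt0].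
  (* Nonnegative coordinates with zero sum all vanish, which avoids matching each index with [r],
     [s] or [t]. *)
  have sum0 : \sum_i x i 0 = 0.
    by rewrite (sum_distinct3 _ rs st rt) xr0 xs0 xt0 !addr0.
  apply/eqP/colP => i; rewrite mxE.
  move/eqP: sum0; rewrite psumr_eq0// => /allP xi0.
  by apply/eqP/xi0; rewrite mem_index_enum.
rewrite (tensor_form_distinct3 _ Asym rs st rt).
(* Commuting puts the squared factor last, as [cbrtMXX] expects. *)
move: Hor; rewrite Ea Eb Ec ![(_ ^+ 3) ^+ 2 * _]mulrC.
rewrite !cbrtMXX ?(ltW a0) ?(ltW b0) ?(ltW c0)// => Hor Hrss Hrtt.
(* Here [X], [Y], [Z] are the unscaled coordinates; the scaled ones are [a * X], [b * Y],
   [c * Z]. *)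
move: xr xs xt cubes_gt0; move: (x r 0) (x s 0) (x t 0) =>
  X Y Z X0 Y0 Z0 cubes_gt0.
have term (k l m : R) : 0 <= m -> k <= l -> k * m <= l * m.
  by move=> m0; exact: ler_wpM2r.
have m21 (u v : R) : 0 <= u -> 0 <= v -> 0 <= u ^+ 2 * v.
  by move=> u0 v0; rewrite mulr_ge0 ?exprn_ge0.
have m12 (u v : R) : 0 <= u -> 0 <= v -> 0 <= u * v ^+ 2.
  by move=> u0 v0; rewrite mulr_ge0 ?exprn_ge0.
have T1 := term _ _ _ (m12 _ _ X0 Y0) Hrss.
have T2 := term _ _ _ (m12 _ _ X0 Z0) Hrtt.
have T3 := mulr_ge0 A123 (mulr_ge0 (mulr_ge0 X0 Y0) Z0).
have aX := mulr_ge0 (ltW a0) X0; have bY := mulr_ge0 (ltW b0) Y0.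
have cZ := mulr_ge0 (ltW c0) Z0.
have [Y3 Z3] : 0 <= (b * Y) ^+ 3 /\ 0 <= (c * Z) ^+ 3 by rewrite !exprn_ge0.
have XY := m12 _ _ aX bY; have XZ := m12 _ _ aX cZ.
(* Both conditions bound the same four coefficients in the same order, so each bound is multiplied
   by its monomial before the cases separate. *)
case: Hor => -[] /(term _ _ _ (m21 _ _ X0 Y0)) T4
  /(term _ _ _ (m21 _ _ X0 Z0)) T5 /(term _ _ _ (m21 _ _ Y0 Z0)) T6
  /(term _ _ _ (m12 _ _ Y0 Z0)) T7.
(* The negative term in $X^2Z$ is absorbed by [Q], and the leftover $XY^2$ term is nonnegative by
   [XY]. Once powers of products are expanded, everything is linear in the monomials. *)
- have Q := quarter_cube_le (c * Z) aX.
  rewrite !exprMn in cubes_gt0 Y3 Z3 XY XZ Q *; lra.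
(* [Q1] consumes the $X^3$ and $XY^2$ terms, [Q2] the $Y^3$ and $YZ^2$ terms, so nothing is used
   twice; the $XZ^2$ term is dropped by [XZ]. *)
- have Q1 := quarter_cube_le (b * Y) aX; have Q2 := quarter_cube_le (c * Z) bY.
  rewrite !exprMn in cubes_gt0 Y3 Z3 XY XZ Q1 Q2 *; lra.
Qed.
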